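(* Let $Alg\,\mathcal{N}$ be a nest algebra on a Hilbert space $\mathbb{H}$, and let $N\in\mathcal{N}$ be a non-trivial element. Let $\delta:Alg\,\mathcal{N}\to Alg\,\mathcal{N}$ be a continuous linear map. Then $\delta$ satisfies \[ A,B\in Alg\,\mathcal{N},\quad AB+BA=P_N\ \Longrightarrow\ 2A\delta(B)+2B\delta(A)=\delta(P_N) \] if and only if $\delta(A)=A\delta(I)$ for all $A\in Alg\,\mathcal{N}$ and $P_N\delta(I)=0$.
   Context: All algebras and vector spaces are over $\mathbb{F}$, where $\mathbb{F}$ is either $\mathbb{R}$ or $\mathbb{C}$. $\mathcal{B}(\mathbb{H})$ is the algebra of bounded linear operators on $\mathbb{H}$, $I$ is the identity operator, and $P_N$ is the (orthogonal) projection of $\mathbb{H}$ onto the closed subspace $N$. A subspace lattice on $\mathbb{H}$ is a collection of norm-closed subspaces of $\mathbb{H}$ that is closed under arbitrary intersections and arbitrary closed linear spans and contains $\{0\}$ and $\mathbb{H}$. A nest $\mathcal{N}$ is a subspace lattice totally ordered by inclusion; $N\in\mathcal{N}$ is non-trivial if $N\neq\{0\},\mathbb{H}$. The nest algebra is $Alg\,\mathcal{N}=\{T\in\mathcal{B}(\mathbb{H}) : T(N)\subseteq N \text{ for all } N\in\mathcal{N}\}$. Continuity refers to the operator norm. *)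

(* Defs.v *)
From HB Require Import structures.
From mathcomp Require Import all_boot all_order all_algebra.
From mathcomp Require Import complex.
From mathcomp Require Import all_classical all_reals topology normedtype.
From mathcomp Require Import ring lra.

Set Implicit Arguments.
Unset Strict Implicit.
Unset Printing Implicit Defensive.

Import Order.TTheory GRing.Theory Num.Theory.
Import numFieldNormedType.Exports.

Local Open Scope classical_set_scope.
Local Open Scope ring_scope.

(* The results hold over the real and over the complex field alike: a
   [scalar_kind] selects which of R and R[i] is the field of scalars. [sconj]
   is conjugation on it, and [sofR], [sRe] relate it to R. Norms take their
   values in the scalars themselves, as nonnegative elements. *)
Variant scalar_kind := RealScalars | ComplexScalars.

Definition scalars (R : realType) (k : scalar_kind) : numFieldType :=
  match k with RealScalars => R | ComplexScalars => R[i] end.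

Definition sconj (R : realType) (k : scalar_kind) :
    {rmorphism scalars R k -> scalars R k} :=
  match k return {rmorphism scalars R k -> scalars R k} with
  | RealScalars => idfun
  | ComplexScalars => @conjc R
  end.

Definition sRe (R : realType) (k : scalar_kind) : scalars R k -> R :=
  match k return scalars R k -> R with
  | RealScalars => id
  | ComplexScalars => @complex.Re R
  end.

Definition sofR {R : realType} (k : scalar_kind) :
    {rmorphism R -> scalars R k} :=
  match k return {rmorphism R -> scalars R k} with
  | RealScalars => idfun
  | ComplexScalars => real_complex R
  end.

Section ScalarTheory.
Context (R : realType) (k : scalar_kind).
Local Notation K := (scalars R k).
Implicit Types (a b : K) (r s : R).

Lemma sofRK r : sRe (sofR k r) = r. Proof. by case: k. Qed.

Lemma sRe_le a b : a <= b -> sRe a <= sRe b.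
Proof. by case: k a b => //= a b; rewrite lecE => /andP[]. Qed.

Lemma sReK a : 0 <= a -> sofR k (sRe a) = a.
Proof.
case: k a => //= a a0; apply: RRe_real; exact: ger0_real.
Qed.

Lemma ler_sofR r s : (sofR k r <= sofR k s) = (r <= s).
Proof. by case: k => //=; rewrite lecR. Qed.

Lemma sRe_is_additive : zmod_morphism (@sRe R k).
Proof. by case: k => //= -[a b] [c d]. Qed.

HB.instance Definition _ :=
  GRing.isZmodMorphism.Build (scalars R k) R (@sRe R k) sRe_is_additive.

Lemma sRe_sofRM r a : sRe (sofR k r * a) = r * sRe a.
Proof. by case: k a => //= -[a b] /=; rewrite mul0r subr0. Qed.

Lemma sconjK a : sconj R k (sconj R k a) = a.
Proof. by case: k a => //= a; rewrite conjcK. Qed.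

Lemma mul_sconj a : a * sconj R k a = `|a| ^+ 2.
Proof.
case: k a => /= a; first by rewrite -expr2 real_normK ?num_real.
by rewrite -normCK.
Qed.

Lemma sRe_sconj a : sRe (sconj R k a) = sRe a.
Proof. by case: k a => //= -[]. Qed.

End ScalarTheory.

HB.mixin Record isHilbert (R : realType) (k : scalar_kind) H
    of CompleteNormedModule (scalars R k) H := {
  inner : {dot H for sconj R k};
  innerE : forall x : H, inner x x = `|x| ^+ 2
}.

#[short(type="hilbertType")]
HB.structure Definition Hilbert (R : realType) (k : scalar_kind) :=
  {H of isHilbert R k H & CompleteNormedModule (scalars R k) H}.

Section BoundedOperators.
Context (R : realType) (k : scalar_kind) (V : normedModType (scalars R k)).
Local Notation K := (scalars R k).

(* In the order of R[i], [a <= b] forces [b - a] to be real, so the bound M is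
   automatically real as soon as V is nonzero. *)
Definition bounded_linear : {pred V -> V} :=
  [pred T | `[< linear T /\ exists M : K, forall x, `|T x| <= M * `|x| >]].

Lemma bounded_linearP (T : V -> V) :
  reflect (linear T /\ exists M : K, forall x, `|T x| <= M * `|x|)
          (T \in bounded_linear).
Proof. exact: asboolP. Qed.

Lemma bounded_linear_submod_closed : submod_closed bounded_linear.
Proof.
split=> [|a S T /bounded_linearP[linS [M hM]] /bounded_linearP[linT [N hN]]].
  apply/bounded_linearP; split=> [b x y|] /=.
    by rewrite -[LHS]/0 -[RHS]/(b *: 0 + 0) scaler0 addr0.
  by exists 0 => x; rewrite mul0r normr0.
apply/bounded_linearP; split=> [b x y|] /=.
  rewrite -[LHS]/(a *: S (b *: x + y) + T (b *: x + y)).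
  rewrite -[RHS]/(b *: (a *: S x + T x) + (a *: S y + T y)).
  by rewrite linS linT !scalerDr !scalerA addrACA mulrC.
exists (`|a| * M + N) => x; rewrite -[_ x]/(a *: S x + T x).
apply: (le_trans (ler_normD _ _)); rewrite mulrDl lerD// normrZ -mulrA.
exact: ler_wpM2l.
Qed.

HB.instance Definition _ :=
  GRing.isSubmodClosed.Build K (V -> V) bounded_linear
    bounded_linear_submod_closed.

Record bounded_op := BOp { bop_fun :> V -> V ; bop_mem : bop_fun \in bounded_linear }.

HB.instance Definition _ := [isSub for bop_fun].
HB.instance Definition _ := [Choice of bounded_op by <:].
HB.instance Definition _ := [SubChoice_isSubLmodule of bounded_op by <:].

Implicit Types S T : bounded_op.

Lemma bopP S T : (forall x, S x = T x) -> S = T.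
Proof. by move=> ST; apply/val_inj/funext. Qed.

Lemma bop_linear T : linear T. Proof. by have /bounded_linearP[] := bop_mem T. Qed.

HB.instance Definition _ T := GRing.isLinear.Build K V V _ T (bop_linear T).

Lemma bop_bounded T : exists2 M : K, 0 <= M & forall x, `|T x| <= M * `|x|.
Proof.
have /bounded_linearP[_ [M hM]] := bop_mem T; exists `|M| => // x.
have h := le_trans (normr_ge0 _) (hM x).
by apply: (le_trans (hM x)); rewrite -(ger0_norm h) normrM normr_id.
Qed.

Lemma bop_id_mem : (id : V -> V) \in bounded_linear.
Proof.
by apply/bounded_linearP; split=> //; exists 1 => x; rewrite mul1r.
Qed.

Lemma bop_comp_mem S T : S \o T \in bounded_linear.
Proof.
apply/bounded_linearP; split=> [a x y /=|]; first by rewrite !linearP.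
have [M M0 hM] := bop_bounded S; have [N N0 hN] := bop_bounded T.
exists (M * N) => x /=; apply: (le_trans (hM _)).
by rewrite -mulrA ler_wpM2l.
Qed.

Definition bop_id := BOp bop_id_mem.
Definition bop_comp S T := BOp (bop_comp_mem S T).

Fact bop_compA : associative bop_comp. Proof. by move=> ? ? ?; exact: bopP. Qed.
Fact bop_comp1 : left_id bop_id bop_comp. Proof. by move=> ?; exact: bopP. Qed.
Fact bop_compr1 : right_id bop_id bop_comp. Proof. by move=> ?; exact: bopP. Qed.
Fact bop_compDl : left_distributive bop_comp +%R.
Proof. by move=> ? ? ?; exact: bopP. Qed.
Fact bop_compDr : right_distributive bop_comp +%R.
Proof. by move=> S T U; apply: bopP => x; exact: linearD. Qed.

(* Only a [pzRingType]: on the zero space, 1 = 0. For the same reason there is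
   no [algType] instance; compatibility with scaling is [bop_scalerAl] and
   [bop_scalerAr]. *)
HB.instance Definition _ := GRing.Zmodule_isPzRing.Build bounded_op
  bop_compA bop_comp1 bop_compr1 bop_compDl bop_compDr.

Lemma bop1E x : (1 : bounded_op) x = x. Proof. by []. Qed.
Lemma bopME S T x : (S * T) x = S (T x). Proof. by []. Qed.
Lemma bopDE S T x : (S + T) x = S x + T x. Proof. by []. Qed.
Lemma bopZE (a : K) T x : (a *: T) x = a *: T x. Proof. by []. Qed.
Lemma bop0E x : (0 : bounded_op) x = 0. Proof. by []. Qed.

Lemma bop_scalerAl (a : K) S T : a *: (S * T) = (a *: S) * T.
Proof. exact: bopP. Qed.
Lemma bop_scalerAr (a : K) S T : a *: (S * T) = S * (a *: T).
Proof. by apply: bopP => x; rewrite bopZE !bopME bopZE linearZ. Qed.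

Definition opnorm T : K :=
  sofR k (sup [set sRe `|T x| | x in [set x : V | `|x| <= 1]]).

Let opnorm_has_sup T :
  has_sup [set sRe `|T x| | x in [set x : V | `|x| <= 1]].
Proof.
split; first by exists (sRe `|T 0|), 0 => //=; rewrite normr0.
have [M M0 hM] := bop_bounded T.
exists (sRe M) => _ [x /= x1 <-]; apply: sRe_le.
by apply: (le_trans (hM x)); rewrite ler_piMr.
Qed.

Lemma opnorm_ge0 T : 0 <= opnorm T.
Proof.
rewrite -(rmorph0 (sofR k)) ler_sofR.
apply: (@le_trans _ _ (sRe `|T 0|)); first by rewrite linear0 normr0 raddf0.
apply: sup_upper_bound => //.
by exists 0 => //=; rewrite normr0.
Qed.

Lemma ler_opnorm T x : `|T x| <= opnorm T * `|x|.
Proof.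
have [->|x0] := eqVneq x 0; first by rewrite linear0 !normr0 mulr0.
rewrite -ler_pdivrMr ?normr_gt0// mulrC.
have -> : `|x|^-1 * `|T x| = `|T (`|x|^-1 *: x)|.
  by rewrite linearZ normrZ normfV normr_id.
rewrite -[leLHS]sReK// ler_sofR; apply: sup_upper_bound => //.
by exists (`|x|^-1 *: x) => //=; rewrite normrZ normfV normr_id mulVf ?normr_eq0.
Qed.

Lemma opnorm_le T (M : K) :
  0 <= M -> (forall x, `|T x| <= M * `|x|) -> opnorm T <= M.
Proof.
move=> M0 hM; rewrite -[M]sReK// ler_sofR.
apply: ge_sup; first by case: (opnorm_has_sup T).
move=> _ [x /= x1 <-]; apply: sRe_le; apply: (le_trans (hM x)).
by rewrite ler_piMr.
Qed.

Fact opnormD S T : opnorm (S + T) <= opnorm S + opnorm T.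
Proof.
apply: opnorm_le => [|x]; first by rewrite addr_ge0 ?opnorm_ge0.
rewrite bopDE mulrDl (le_trans (ler_normD _ _))//.
by rewrite lerD ?ler_opnorm.
Qed.

Fact opnormZ (a : K) T : opnorm (a *: T) = `|a| * opnorm T.
Proof.
have le b U : opnorm (b *: U) <= `|b| * opnorm U.
  apply: opnorm_le => [|x]; first by rewrite mulr_ge0 ?opnorm_ge0.
  by rewrite bopZE normrZ -mulrA ler_wpM2l ?ler_opnorm.
apply/le_anti; rewrite le /=.
have [->|a0] := eqVneq a 0; first by rewrite normr0 mul0r opnorm_ge0.
rewrite -ler_pdivlMl ?normr_gt0// -normfV.
by have := le a^-1 (a *: T); rewrite scalerA mulVf// scale1r.
Qed.

Fact opnorm0_eq0 T : opnorm T = 0 -> T = 0.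
Proof.
move=> T0; apply: bopP => x; apply/eqP; rewrite bop0E -normr_le0.
by rewrite (le_trans (ler_opnorm T x))// T0 mul0r.
Qed.

HB.instance Definition _ :=
  Lmodule_isNormed.Build K bounded_op opnormD opnormZ opnorm0_eq0.

Lemma bop_normE T : `|T| = opnorm T. Proof. by []. Qed.

Lemma bop_normM S T : `|S * T| <= `|S| * `|T|.
Proof.
apply: opnorm_le => [|x]; first by rewrite mulr_ge0.
rewrite bopME (le_trans (ler_opnorm _ _))// -mulrA.
by rewrite ler_wpM2l ?ler_opnorm ?opnorm_ge0.
Qed.

End BoundedOperators.

Section Nests.
Context (R : realType) (k : scalar_kind) (V : normedModType (scalars R k)).

Definition lin_subspace (M : set V) : Prop :=
  M 0 /\ forall (a : scalars R k) x y, M x -> M y -> M (a *: x + y).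

Definition closed_lin_span (A : set V) : set V :=
  closure (smallest lin_subspace A).

(* The empty subfamily is allowed in the closure conditions; its intersection
   is the whole space and its closed span is {0}. *)
Definition subspace_lattice (L : set (set V)) : Prop :=
  [/\ forall M, L M -> lin_subspace M /\ closed M,
      forall F, F `<=` L -> L (\bigcap_(M in F) M),
      forall F, F `<=` L -> L (closed_lin_span (\bigcup_(M in F) M)),
      L [set 0] & L setT].

Definition is_nest (L : set (set V)) : Prop :=
  subspace_lattice L /\ forall M N, L M -> L N -> M `<=` N \/ N `<=` M.

Record nest := Nest { nest_sets :> set V -> Prop ; nestP : is_nest nest_sets }.

Section NestAlgebra.
Variable NN : nest.

Definition nest_preserving : {pred bounded_op V} :=
  [pred T : bounded_op V | `[< forall N, NN N -> T @` N `<=` N >]].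

Lemma nest_preservingP (T : bounded_op V) :
  reflect (forall N x, NN N -> N x -> N (T x)) (T \in nest_preserving).
Proof.
apply: (iffP (asboolP _)) => h.
  by move=> N x NNN Nx; apply: (h N NNN); exists x.
by move=> N NNN _ [x Nx <-]; exact: h.
Qed.

Lemma nest_lin_subspace N : NN N -> lin_subspace N.
Proof. by move: (nestP NN) => [[h _ _ _ _] _] /h[]. Qed.

Lemma nest_closed N : NN N -> closed N.
Proof. by move: (nestP NN) => [[h _ _ _ _] _] /h[]. Qed.

Lemma nest_preserving_submod_closed : submod_closed nest_preserving.
Proof.
split=> [|a S T /nest_preservingP hS /nest_preservingP hT].
  apply/nest_preservingP => N x /nest_lin_subspace[N0 _] _.
  by rewrite bop0E.
apply/nest_preservingP => N x NNN Nx; rewrite bopDE bopZE.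
by apply: (nest_lin_subspace NNN).2; [exact: hS|exact: hT].
Qed.

HB.instance Definition _ :=
  GRing.isSubmodClosed.Build (scalars R k) (bounded_op V) nest_preserving
    nest_preserving_submod_closed.

Lemma nest_preserving_mulr_closed : mulr_closed nest_preserving.
Proof.
split=> [|S T /nest_preservingP hS /nest_preservingP hT].
  exact/nest_preservingP.
apply/nest_preservingP => N x NNN Nx.
by rewrite bopME; apply: hS => //; exact: hT.
Qed.

HB.instance Definition _ :=
  GRing.isMulClosed.Build (bounded_op V) nest_preserving nest_preserving_mulr_closed.

Record nest_alg :=
  NestAlg { nest_op :> bounded_op V ; nest_op_mem : nest_op \in nest_preserving }.

HB.instance Definition _ := [isSub for nest_op].
HB.instance Definition _ := [Choice of nest_alg by <:].
HB.instance Definition _ := [SubChoice_isSubLmodule of nest_alg by <:].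
HB.instance Definition _ :=
  GRing.SubZmodule_isSubPzRing.Build (bounded_op V) nest_preserving nest_alg
    (subringClosedP nest_preserving).

Definition nest_alg_norm (T : nest_alg) : scalars R k := `|nest_op T|.

Fact nest_alg_normD S T :
  nest_alg_norm (S + T) <= nest_alg_norm S + nest_alg_norm T.
Proof. exact: ler_normD. Qed.

Fact nest_alg_normZ (a : scalars R k) T :
  nest_alg_norm (a *: T) = `|a| * nest_alg_norm T.
Proof. exact: normrZ. Qed.

Fact nest_alg_norm0_eq0 T : nest_alg_norm T = 0 -> T = 0.
Proof. by move/normr0_eq0 => T0; exact: val_inj. Qed.

HB.instance Definition _ :=
  Lmodule_isNormed.Build (scalars R k) nest_alg
    nest_alg_normD nest_alg_normZ nest_alg_norm0_eq0.

End NestAlgebra.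
End Nests.

Section Projection.
Context (R : realType) (k : scalar_kind) (H : hilbertType R k).
Local Notation K := (scalars R k).
Implicit Types (x y z : H) (N : set H).

Definition orthogonal_compl N : set H :=
  [set y | forall x, N x -> inner y x = 0].

(* The default value 0 is never used when N is a closed subspace of H, by
   [orth_projP]; [orth_proj_unique] shows that no choice is involved. *)
Definition orth_proj N (x : H) : H :=
  xget 0 [set p | N p /\ orthogonal_compl N (x - p)].

Let nr x : R := sRe `|x|.

Let nrE x : `|x| = sofR k (nr x). Proof. by rewrite /nr sReK. Qed.

Let nr_ge0 x : 0 <= nr x.
Proof. by rewrite -(ler_sofR k) rmorph0 -nrE. Qed.

Let nrD x y : nr (x + y) <= nr x + nr y.
Proof. by rewrite -(ler_sofR k) rmorphD -!nrE ler_normD. Qed.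

Let nr_inner x : sRe (inner x x) = nr x ^+ 2.
Proof. by rewrite innerE nrE -rmorphXn sofRK. Qed.

Let innerC x y : inner x y = sconj R k (inner y x).
Proof. by rewrite hermC /= expr0 mul1r. Qed.

Let nr_sqrD x y :
  nr (x + y) ^+ 2 = nr x ^+ 2 + nr y ^+ 2 + 2 * sRe (inner x y).
Proof.
rewrite -!nr_inner linearDl /= !linearDr /= !raddfD /= [inner y x]innerC.
rewrite sRe_sconj; ring.
Qed.

Let nr_sqrB x y :
  nr (x - y) ^+ 2 = nr x ^+ 2 + nr y ^+ 2 - 2 * sRe (inner x y).
Proof.
have nrN : nr (- y) = nr y by rewrite /nr normrN.
by rewrite nr_sqrD nrN linearNr /= raddfN /= mulrN.
Qed.

Let nrZ (a : K) x : nr (a *: x) = sRe `|a| * nr x.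
Proof. by rewrite /nr normrZ -[in LHS](sReK (normr_ge0 a)) sRe_sofRM. Qed.

Let min_orthogonal x z :
  (forall a : K, nr x <= nr (x - a *: z)) -> inner x z = 0.
Proof.
move=> xmin; set c := inner x z.
apply/eqP; rewrite -normr_eq0.
have cE : `|c| = sofR k (sRe `|c|) by rewrite sReK.
set q := sRe `|c| in cE.
have key (s : R) : 0 < s -> 2 * q ^+ 2 <= s * (q ^+ 2 * nr z ^+ 2).
  move=> s0; have := xmin (sofR k s * c).
  rewrite -(ler_pXn2r (n := 2)) ?nnegrE// nr_sqrB nrZ.
  have -> : sRe (inner x ((sofR k s * c) *: z)) = s * q ^+ 2.
    rewrite linearZr_LR /= rmorphM /= -mulrA [_ * inner _ _]mulrC mul_sconj.
    rewrite [X in X * _](_ : _ = sofR k s); last first.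
      by clear; case: k s => //= s; exact: conjc_real.
    by rewrite cE -rmorphXn -rmorphM sofRK.
  have -> : sRe `|sofR k s * c| = s * q.
    rewrite normrM ger0_norm; last by rewrite -(rmorph0 (sofR k)) ler_sofR ltW.
    by rewrite cE -rmorphM sofRK.
  rewrite -addrA lerDl subr_ge0 !exprMn => h.
  by rewrite -(ler_pM2l s0); move: h; rewrite mulrCA !expr2 !mulrA.
have z1 : 0 < nr z ^+ 2 + 1 by rewrite ltr_wpDl ?sqr_ge0.
have := key (nr z ^+ 2 + 1)^-1; rewrite invr_gt0 => /(_ z1).
rewrite ler_pdivlMl// => h.
have : q ^+ 2 = 0.
  have := sqr_ge0 q; have := sqr_ge0 (nr z) => z0 q0.
  by apply/eqP; rewrite eq_le q0 andbT; nra.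
by move=> /eqP; rewrite sqrf_eq0 cE => /eqP ->; rewrite rmorph0.
Qed.

Let min_exists N x : lin_subspace N -> closed N ->
  exists2 p, N p & forall y, N y -> nr (x - p) <= nr (x - y).
Proof.
move=> [N0 Nlin] clN.
pose D := [set nr (x - y) | y in N].
have Dn0 : D !=set0 by exists (nr (x - 0)), 0.
have Dlb : has_lbound D by exists 0 => _ [y _ <-].
have Dinf : has_inf D by [].
set d := inf D.
have d_le y : N y -> d <= nr (x - y).
  by move=> Ny; apply: ge_inf => //; exists y.
have d0 : 0 <= d by apply: lb_le_inf => // _ [y _ <-].
pose E (e : R) := [set y | N y /\ nr (x - y) < d + e].
have En0 e : 0 < e -> E e !=set0.
  by move=> e0; have [_ [y Ny <-] yd] := inf_adherent e0 Dinf; exists y.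
have Esub e1 e2 : e1 <= e2 -> E e1 `<=` E e2.
  by move=> e12 y [Ny yd]; split=> //; rewrite (lt_le_trans yd)// lerD2l.
pose F : set_system H := [set A | exists2 e : R, 0 < e & E e `<=` A].
have FF : ProperFilter F.
  apply: Build_ProperFilter_ex => [A [e e0 EA]|].
    by have [y /EA] := En0 e e0; exists y.
  split=> [|A B [e e0 EA] [f f0 EB]|A B AB [e e0 EA]].
  - by exists 1.
  - exists (Num.min e f) => [|y Ey]; first by rewrite lt_min e0.
    split; [apply: EA|apply: EB]; apply: Esub Ey; rewrite ge_min lexx ?orbT//.
  - by exists e => // y /EA /AB.
have Fc : cauchy F.
  apply: cauchy_exP => eps eps0.
  have [r r0 rE] : exists2 r, 0 < r & eps = sofR k r.
    have epsE := sReK (ltW eps0); exists (sRe eps) => //.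
    rewrite lt_neqAle -(ler_sofR k) rmorph0 epsE ltW// andbT.
    by apply/eqP => h; move: eps0; rewrite -epsE -h rmorph0 ltxx.
  pose c := 8 * d + 5.
  have c0 : 0 < c by rewrite /c; lra.
  pose e := Num.min 1 (r ^+ 2 / c).
  have e0 : 0 < e by rewrite lt_min ltr01 divr_gt0// exprn_gt0.
  have e1 : e <= 1 by rewrite ge_min lexx.
  have er : e * c <= r ^+ 2 by rewrite -ler_pdivlMr// ge_min lexx orbT.
  have [y [Ny yd]] := En0 e e0.
  exists y; exists e => // z [Nz zd].
  rewrite -ball_normE /ball_ /= nrE rE.
  rewrite lt_neqAle ler_sofR.
  have mid_d : d <= nr (x - 2^-1 *: (y + z)).
    apply: d_le; rewrite -[_ *: _]addr0; apply: (Nlin) => //.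
    by rewrite -[y]scale1r; apply: (Nlin).
  have midE : nr ((x - y) + (x - z)) = 2 * nr (x - 2^-1 *: (y + z)).
    have -> : (x - y) + (x - z) = (2 : K) *: (x - 2^-1 *: (y + z)).
      rewrite scalerBr scalerA mulfV ?pnatr_eq0// scale1r scaler_nat mulr2n.
      by rewrite addrACA opprD.
    rewrite nrZ; congr (_ * _).
    by rewrite normr_nat -(rmorph_nat (sofR k)) sofRK.
  have yzE : nr ((x - z) - (x - y)) = nr (y - z).
    by congr nr; rewrite opprB addrC addrA subrK.
  have par : nr (y - z) ^+ 2 < r ^+ 2.
    have := nr_sqrD (x - z) (x - y); have := nr_sqrB (x - z) (x - y).
    rewrite yzE [(x - z) + _]addrC midE.
    have := nr_ge0 (x - y); have := nr_ge0 (x - z).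
    move: (sRe _) (nr (y - z) ^+ 2) mid_d zd yd => ? w.
    rewrite /c in er c0.
    move: (nr (x - _ *: _)) (nr (x - z)) (nr (x - y)) => m u v md zd yd u0 v0.
    move=> h1 h2.
    have m2 : d ^+ 2 <= m ^+ 2 by rewrite ler_pXn2r ?nnegrE// (le_trans d0).
    have u2 : u ^+ 2 <= (d + e) ^+ 2.
      by rewrite ler_pXn2r ?nnegrE//; lra.
    have v2 : v ^+ 2 <= (d + e) ^+ 2.
      by rewrite ler_pXn2r ?nnegrE//; lra.
    have e2 : e * e <= e by rewrite ler_piMl// ltW.
    nra.
  have lt : nr (y - z) < r.
    by rewrite -(ltr_pXn2r (n := 2)) ?nnegrE ?nr_ge0// ltW.
  rewrite ltW// andbT; apply/eqP => /(congr1 (@sRe R k)).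
  by rewrite !sofRK => h; rewrite h ltxx in lt.
have [p Fp] : exists p : H, F --> p by exists (lim F); exact: cauchy_cvg.
have Np : N p.
  apply: (@closed_cvg _ _ F _ id N clN _ p Fp).
  by exists 1 => // y [].
exists p => // y Ny; apply: le_trans (d_le y Ny).
apply/ler_addgt0Pr => e e0.
have e20 : 0 < e / 2 by rewrite divr_gt0.
have : F (ball p (sofR k (e / 2))).
  apply: Fp; apply: nbhsx_ballx.
  rewrite lt_neqAle -(rmorph0 (sofR k)) ler_sofR ltW// andbT.
  apply/eqP => /(congr1 (@sRe R k)); rewrite !sofRK => h.
  by rewrite -h ltxx in e20.
move=> [f f0 Ef].
have g0 : 0 < Num.min f (e / 2) by rewrite lt_min f0.
have [z Ez] := En0 _ g0.
have : ball p (sofR k (e / 2)) z.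
  by apply: Ef; apply: Esub Ez; rewrite ge_min lexx.
rewrite -ball_normE /ball_ /= nrE => /ltW; rewrite ler_sofR => pz.
have [_ xz] : E (e / 2) z by apply: Esub Ez; rewrite ge_min lexx orbT.
have := nrD (x - z) (z - p).
have -> : nr (z - p) = nr (p - z) by rewrite /nr distrC.
rewrite addrA subrK; lra.
Qed.

Section ClosedSubspace.
Variables (N : set H) (subN : lin_subspace N) (clN : closed N).

Lemma orth_projP x : N (orth_proj N x) /\ orthogonal_compl N (x - orth_proj N x).
Proof.
have [p Np pmin] := min_exists x subN clN.
apply: (@xgetPex _ 0 [set p | N p /\ orthogonal_compl N (x - p)]).
exists p; split=> // z Nz; apply: min_orthogonal => a.
rewrite -addrA -opprD; apply: pmin; rewrite addrC; exact: subN.2.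
Qed.

Lemma orth_proj_unique x p :
  N p -> orthogonal_compl N (x - p) -> orth_proj N x = p.
Proof.
move=> Np op; have [Nq oq] := orth_projP x.
set q := orth_proj N x in Nq oq *.
have Nd : N (q - p) by rewrite addrC -scaleN1r; exact: subN.2.
apply/eqP; rewrite -subr_eq0 -normr_eq0 -sqrf_eq0 -innerE.
have {1}-> : q - p = (x - p) - (x - q) by rewrite opprB [RHS]addrC addrA subrK.
by rewrite linearBl /= op// oq// subrr.
Qed.

Lemma orth_proj_mem : orth_proj N \in @bounded_linear R k H.
Proof.
apply/bounded_linearP; split=> [a x y|].
  have [[Nx ox] [Ny oy]] := (orth_projP x, orth_projP y).
  apply: orth_proj_unique; first exact: subN.2.
  move=> z Nz; rewrite opprD addrACA -scalerBr.
  by rewrite linearDl /= linearZl_LR /= ox// oy// mulr0 addr0.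
exists 1 => x; rewrite mul1r !nrE ler_sofR.
have [Nx ox] := orth_projP x.
rewrite -(ler_pXn2r (n := 2)) ?nnegrE//.
rewrite -[x in leRHS](subrK (orth_proj N x)) nr_sqrD ox// raddf0 mulr0 addr0.
by rewrite lerDr sqr_ge0.
Qed.

End ClosedSubspace.

Variable NN : nest H.

Definition proj_op N (NNN : NN N) : bounded_op H :=
  BOp (orth_proj_mem (nest_lin_subspace NNN) (nest_closed NNN)).

Lemma proj_op_mem N (NNN : NN N) : proj_op NNN \in nest_preserving NN.
Proof.
apply/nest_preservingP => M x NNM Mx.
have subN := nest_lin_subspace NNN; have clN := nest_closed NNN.
have [NM|MN] := (nestP NN).2 _ _ NNN NNM.
  by apply: NM; have [] := orth_projP subN clN x.
rewrite (_ : proj_op NNN x = x)//.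
apply: orth_proj_unique => // [|y _]; first exact: MN.
by rewrite subrr linear0l.
Qed.

Definition nest_proj N (NNN : NN N) : nest_alg NN :=
  NestAlg (proj_op_mem NNN).

End Projection.

(* Main.v *)
Require Import Defs.
From mathcomp Require Import all_boot all_order all_algebra.
From mathcomp Require Import complex.
From mathcomp Require Import all_classical all_reals topology normedtype.
From mathcomp Require Import ring.

Set Implicit Arguments.
Unset Strict Implicit.
Unset Printing Implicit Defensive.

Import Order.TTheory GRing.Theory Num.Theory.
Import numFieldNormedType.Exports.

Local Open Scope classical_set_scope.
Local Open Scope ring_scope.

(* Write P = P_N and Q = 1 - P. Taking A = B = P up to a scalar gives
   delta P = 0, and the hypothesis becomes A delta(B) + B delta(A) = 0 whenever
   AB + BA is a multiple of P. For m in P Alg Q and b in Q Alg Q, the pair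
   A = P - m - mb + b, B = P + m yields delta(m) = m delta(1) and
   m (delta(b) - b delta(1)) = 0; since P Alg Q contains all rank-one operators
   from the range of Q to N, delta(b) = b delta(1).

   It remains to kill delta on P Alg P. The pair a + Q, a^-1 (a invertible in
   P Alg P) shows that delta maps P Alg P into P Alg. If a^2 = P then
   delta(a) = 0, so delta vanishes on idempotents e <= P and on the corners
   e Alg f and f Alg e, where f = P - e. For b invertible in f Alg f and m in
   e Alg f, the pairs n e + b + m, e + n b^-1 - m b^-1 with n = 1, 2 give
   e delta(b^-1) = 0 and m delta(b^-1) = 0. With e the projection on a nonzero
   member M of the nest below N, this forces delta(a) to have its range in M.
   So if v = delta(a) x is nonzero, it lies in every nonzero member of the nest,
   hence the orthogonal projection e on the line of v is in the nest algebra;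
   as eae is a multiple of e, the same identities give e delta(a) = 0, and
   v = e v = 0.

   Everything extends from invertible elements of a corner to the whole corner
   by the Neumann series. *)

(** * The Jordan condition at an idempotent of a ring *)

Section JordanAtIdempotent.
Variables (T : pzRingType) (D : {additive T -> T}) (P : T).
Hypothesis torsion_free : forall (n : nat) (u : T), u *+ n.+1 = 0 -> u = 0.
Hypothesis PP : P * P = P.
Hypothesis DP : D P = 0.
Hypothesis jordanD :
  forall (n : nat) A B, A * B + B * A = P *+ n.+1 -> A * D B + B * D A = 0.

Local Notation Q := (1 - P).

Lemma PQ0 : P * Q = 0. Proof. by rewrite mulrBr mulr1 PP subrr. Qed.
Lemma QP0 : Q * P = 0. Proof. by rewrite mulrBl mul1r PP subrr. Qed.

Lemma D_compl_corner b : P * b = 0 -> b * P = 0 -> P * D b = 0.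
Proof.
move=> Pb bP; have := @jordanD 1 (P + b) P.
rewrite mulrDl mulrDr PP Pb bP !addr0 => /(_ erefl).
by rewrite DP mulr0 add0r raddfD /= DP add0r.
Qed.

(** Since [m * m = b * m = 0] and the term [- m * b] cancels the one created in [BA], the products
    are [P + m] and [P - m] whatever [b] is. *)
Lemma offdiag_pair m b : P * m = m -> m * P = 0 -> P * b = 0 -> b * P = 0 ->
  (P - m - m * b + b) * D m + (P + m) * D (P - m - m * b + b) = 0.
Proof.
move=> Pm mP Pb bP.
have mm : m * m = 0 by rewrite -{2}Pm mulrA mP mul0r.
have bm : b * m = 0 by rewrite -Pm mulrA bP mul0r.
have AB : (P - m - m * b + b) * (P + m) = P + m.
  rewrite mulrDr !(mulrDl, mulNr) PP Pm mP bP mm bm -!mulrA bP bm !mulr0.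
  by rewrite !(addr0, oppr0).
have BA : (P + m) * (P - m - m * b + b) = P - m.
  rewrite mulrDl !(mulrDr, mulrN) !mulrA PP Pm mP Pb mm mul0r.
  by rewrite !(addr0, oppr0, add0r) subrK.
have := @jordanD 1 (P - m - m * b + b) (P + m).
rewrite AB BA addrACA subrr addr0 -mulr2n => /(_ erefl).
by rewrite [D (P + m)]raddfD /= DP add0r.
Qed.

Lemma compl_corner_D_offdiag m b : P * m = m -> m * P = 0 ->
  P * b = 0 -> b * P = 0 -> b * D m = 0.
Proof.
move=> Pm mP Pb bP; have := congr1 ( *%R Q) (offdiag_pair Pm mP Pb bP).
have Qm : Q * m = 0 by rewrite mulrBl mul1r Pm subrr.
have Qb : Q * b = b by rewrite mulrBl mul1r Pb subr0.
rewrite mulrDr !mulrA !(mulrDr Q) !mulrN !mulrA QP0 Qm Qb mul0r.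
by rewrite !(addr0, oppr0, add0r) mul0r addr0 mulr0.
Qed.

Lemma D_offdiag_left m : P * m = m -> m * P = 0 -> D m = P * D m.
Proof.
move=> Pm mP; have := compl_corner_D_offdiag Pm mP PQ0 QP0.
by move/eqP; rewrite mulrBl mul1r subr_eq0 => /eqP.
Qed.

(** In [offdiag_pair] the two terms [P * D m] cancel, and a product such as [m * D (m * b)] vanishes
    because [D] maps off-diagonal elements into [P T]; [m * D b - D (m * b)] remains. *)
Lemma D_offdiagM m b : P * m = m -> m * P = 0 -> P * b = 0 -> b * P = 0 ->
  D (m * b) = m * D b.
Proof.
move=> Pm mP Pb bP; have := offdiag_pair Pm mP Pb bP.
have Pmb : P * (m * b) = m * b by rewrite mulrA Pm.
have mbP : m * b * P = 0 by rewrite -mulrA bP mulr0.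
have mD0 n n' : n * P = 0 -> P * n' = n' -> n' * P = 0 -> n * D n' = 0.
  by move=> nP Pn' nP'; rewrite D_offdiag_left// mulrA nP mul0r.
rewrite !(raddfD, raddfN) /= DP add0r.
rewrite !mulrDl !mulrDr !mulNr !mulrN.
have mbDm : m * b * D m = 0 by exact: mD0.
have mDmb : m * D (m * b) = 0 by exact: mD0.
rewrite (mD0 m m) // mbDm mDmb (compl_corner_D_offdiag Pm mP Pb bP).
rewrite (D_compl_corner Pb bP) -!D_offdiag_left // !(addr0, oppr0, add0r).
by rewrite addrA addrA subrr sub0r addrC => /eqP; rewrite subr_eq0 => /eqP.
Qed.

Lemma D_offdiag m : P * m = m -> m * P = 0 -> D m = m * D 1.
Proof.
move=> Pm mP; rewrite -[1](subrK P) raddfD /= DP addr0.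
rewrite -D_offdiagM ?PQ0 ?QP0//; by rewrite mulrBr mulr1 mP subr0.
Qed.

(** For off-diagonal [m], both [m * D b] and [m * b * D 1] equal [D (m * b)], so [m] kills the
    defect [D b - b * D 1]. *)
Lemma D_compl_cornerE :
  (forall t, P * t = 0 -> (forall m, P * m = m -> m * P = 0 -> m * t = 0) ->
     t = 0) ->
  forall b, P * b = 0 -> b * P = 0 -> D b = b * D 1.
Proof.
move=> faith b Pb bP; apply/eqP; rewrite -subr_eq0; apply/eqP/faith.
  by rewrite mulrBr mulrA Pb mul0r subr0 D_compl_corner.
move=> m Pm mP; rewrite mulrBr -D_offdiagM// mulrA.
rewrite D_offdiag ?mulrA ?Pm ?subrr//.
by rewrite -mulrA bP mulr0.
Qed.

(** The summand [Q] in the pair [a + Q], [a'] leaves the anticommutator equal to [2P], and left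
    multiplication by [Q] then isolates [Q * D a']. *)
Lemma D_corner_unit a a' : P * a = a -> a * P = a -> P * a' = a' ->
  a' * P = a' -> a * a' = P -> a' * a = P -> D a' = P * D a'.
Proof.
move=> Pa aP Pa' aP' aa' a'a.
have Qa : Q * a = 0 by rewrite mulrBl mul1r Pa subrr.
have Qa' : Q * a' = 0 by rewrite mulrBl mul1r Pa' subrr.
have := @jordanD 1 (a + Q) a'.
rewrite mulrDl mulrDr Qa' mulrBr mulr1 aP' subrr !addr0 aa' a'a.
move=> /(_ erefl) /(congr1 ( *%R Q)).
rewrite mulr0 mulrDr !mulrA Qa' mul0r addr0 mulrDr Qa add0r.
rewrite [Q * Q]mulrBr mulr1 QP0 subr0 mulrBl mul1r => /eqP.
by rewrite subr_eq0 => /eqP.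
Qed.

(** Split [A = AP + PAQ + QAQ]; invariance puts [AP] in the corner, and [P * D 1 = 0] gives
    [A * Q * D 1 = A * D 1]. *)
Lemma D_from_corners :
  (forall b, P * b = 0 -> b * P = 0 -> D b = b * D 1) ->
  (forall a, P * a = a -> a * P = a -> D a = 0) ->
  forall A, P * A * P = A * P -> D A = A * D 1.
Proof.
move=> Dcompl Dcorner A PAP.
have PD1 : P * D 1 = 0.
  by rewrite -[1](subrK P) raddfD /= DP addr0 D_compl_corner ?PQ0 ?QP0.
have QD1 : Q * D 1 = D 1 by rewrite mulrBl mul1r PD1 subr0.
have -> : D A = D (A * P) + D (P * A * Q) + D (Q * A * Q).
  rewrite -!raddfD /= -addrA -!mulrDl [P + Q]addrC subrK mul1r -mulrDr.
  by rewrite [P + Q]addrC subrK mulr1.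
have -> : D (A * P) = 0 by apply: Dcorner; rewrite ?mulrA// -mulrA PP.
have -> : D (P * A * Q) = P * A * Q * D 1.
  by apply: D_offdiag; [rewrite !mulrA PP|rewrite -mulrA QP0 mulr0].
have -> : D (Q * A * Q) = Q * A * Q * D 1.
  apply: Dcompl; first by rewrite !mulrA PQ0 !mul0r.
  by rewrite -(mulrA _ Q P) QP0 mulr0.
by rewrite add0r -mulrDl -!mulrDl [P + Q]addrC subrK mul1r -mulrA QD1.
Qed.

(** * A splitting of [P] into two orthogonal idempotents *)

Section Corner.
(** [D_corner_unit] proves this for invertible elements of the corner; passing to all of them takes
    a norm, so it is assumed here. *)
Hypothesis D_corner_left : forall a, P * a = a -> a * P = a -> D a = P * D a.

Lemma D_corner_involution a : P * a = a -> a * P = a -> a * a = P -> D a = 0.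
Proof.
move=> Pa aP aa; have := @jordanD 1 a a.
rewrite aa => /(_ erefl); rewrite -mulr2n => /torsion_free aDa.
by rewrite D_corner_left // -aa -mulrA aDa mulr0.
Qed.

Variables e f : T.
Hypotheses (ee : e * e = e) (ff : f * f = f) (ef : e * f = 0) (fe : f * e = 0)
  (efP : e + f = P).

Lemma D_idempotent_l : D e = 0.
Proof.
have De : D (e - f) = 0.
  apply: D_corner_involution; rewrite -?efP.
  - by rewrite mulrDl !mulrBr ee ff ef fe subr0 sub0r.
  - by rewrite mulrDr !mulrBl ee ff ef fe subr0 sub0r.
  - by rewrite mulrBl !mulrBr ee ff ef fe subr0 sub0r opprK.
have : D e *+ 2 = 0.
  rewrite -[RHS]addr0 -{1}De -DP -efP -raddfD /= addrC.
  by rewrite addrACA subrr addr0 mulr2n raddfD.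
exact: torsion_free.
Qed.

Lemma D_idempotent_r : D f = 0.
Proof. by have := DP; rewrite -efP raddfD /= D_idempotent_l add0r. Qed.

Lemma D_corner_offdiag m : e * m = m -> m * f = m -> D m = 0.
Proof.
move=> em mf.
have fm : f * m = 0 by rewrite -em mulrA fe mul0r.
have me : m * e = 0 by rewrite -mf -mulrA fe mulr0.
have mm : m * m = 0 by rewrite -{2}em mulrA me mul0r.
(* The mixed terms [m] and [- m] of the square cancel, so this is again a square root of [P]. *)
have : D (e - f + m) = 0.
  apply: D_corner_involution; rewrite -?efP.
  - rewrite mulrDl !mulrDr !mulrN ee ff ef fe em fm oppr0 !addr0 add0r.
    by rewrite addrAC.
  - rewrite mulrDr !mulrDl !mulNr ee ff ef fe mf me oppr0 !addr0 !add0r.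
    by rewrite addrA.
  rewrite !(mulrDl, mulrDr, mulNr, mulrN) ee ff ef fe em fm me mf mm.
  rewrite !(oppr0, addr0, add0r, opprK).
  by rewrite addrAC addrK.
by rewrite raddfD raddfB /= D_idempotent_l D_idempotent_r subrr add0r.
Qed.

Section CornerUnit.
Variables b b' : T.
Hypotheses (fb : f * b = b) (bf : b * f = b) (fb' : f * b' = b')
  (bf' : b' * f = b') (bb' : b * b' = f) (b'b : b' * b = f).

(** The pair [A], [B] satisfies [AB = BA = sP] for every [s = n.+1]; comparing two values of [s]
    will separate the terms. *)
Lemma corner_unit_pair m n : e * m = m -> m * f = m ->
  (e * D b' *+ n.+1 + m * D b') *+ n.+1 + (e - m * b') * D b = 0.
Proof.
move=> em mf.
have fm : f * m = 0 by rewrite -em mulrA fe mul0r.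
have me : m * e = 0 by rewrite -mf -mulrA fe mulr0.
have eb : e * b = 0 by rewrite -fb mulrA ef mul0r.
have be : b * e = 0 by rewrite -bf -mulrA fe mulr0.
have eb' : e * b' = 0 by rewrite -fb' mulrA ef mul0r.
have be' : b' * e = 0 by rewrite -bf' -mulrA fe mulr0.
have mm : m * m = 0 by rewrite -{2}em mulrA me mul0r.
have bm : b * m = 0 by rewrite -bf -mulrA fm mulr0.
have bm' : b' * m = 0 by rewrite -bf' -mulrA fm mulr0.
have mb'0 : D (m * b') = 0.
  by apply: D_corner_offdiag; rewrite ?mulrA ?em// -mulrA bf'.
set s := n.+1; set A := e *+ s + b + m; set B := e + b' *+ s - m * b'.
have DA : D A = D b.
  rewrite /A !raddfD raddfMn /= D_idempotent_l (D_corner_offdiag em mf).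
  by rewrite mul0rn add0r addr0.
have DB : D B = D b' *+ s.
  by rewrite /B raddfB raddfD raddfMn /= D_idempotent_l mb'0 add0r subr0.
have AB : A * B = P *+ s.
  rewrite /A /B -efP mulrnDl !(mulrDl, mulrDr, mulNr, mulrN, mulrnAl, mulrnAr).
  rewrite !mulrA ee eb' em be bb' bm me mm !mul0r.
  rewrite !(mul0rn, oppr0, addr0, add0r).
  by rewrite addrAC subrK.
have BA : B * A = P *+ s.
  rewrite /A /B -efP mulrnDl !(mulrDl, mulrDr, mulNr, mulrN, mulrnAl, mulrnAr).
  rewrite ee eb em be' b'b bm' -!mulrA be' b'b bm' mf mulr0.
  rewrite !(mul0rn, oppr0, addr0, add0r).
  by rewrite addrAC addrK.
(* The index is shifted: [2s] is the successor of [n + n.+1]. *)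
have := @jordanD (n + n.+1) A B; rewrite AB BA -mulrnDr => /(_ erefl).
rewrite DA DB => /(congr1 ( *%R e)); rewrite mulr0 => <-.
have eA : e * A = e *+ s + m by rewrite !mulrDr mulrnAr ee eb em addr0.
have eB : e * B = e - m * b'.
  by rewrite mulrBr mulrDr mulrnAr ee eb' mul0rn addr0 mulrA em.
by rewrite mulrDr !mulrA eA eB mulrnAr [(_ + m) * _]mulrDl mulrnAl.
Qed.

Lemma corner_unit_D : e * D b' = 0.
Proof.
have h n : e * D b' *+ n.+1 *+ n.+1 + e * D b = 0.
  have := @corner_unit_pair 0 n; rewrite mulr0 !mul0r => /(_ erefl erefl).
  by rewrite addr0 subr0.
(* With [m = 0], the cases [s = 2] and [s = 1] differ by [4 - 1 = 3] times [e * D b']. *)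
have /addIr/eqP := etrans (h 1) (esym (h 0)).
by rewrite -!mulrnA -subr_eq0 -mulrnBr// => /eqP/torsion_free.
Qed.

Lemma offdiag_corner_unit_D m : e * m = m -> m * f = m -> m * D b' = 0.
Proof.
move=> em mf.
have h n : m * D b' *+ n.+1 + (e - m * b') * D b = 0.
  by rewrite -(corner_unit_pair n em mf) corner_unit_D mul0rn add0r.
(* The quadratic term in [s] has gone, so the same two cases differ by [m * D b'] itself. *)
have /addIr/eqP := etrans (h 1) (esym (h 0)).
by rewrite -subr_eq0 -mulrnBr// => /eqP.
Qed.

End CornerUnit.
End Corner.

Lemma D_diagonal : (forall a, P * a = a -> a * P = a -> D a = P * D a) ->
  forall e f, e * e = e -> f * f = f -> e * f = 0 -> f * e = 0 -> e + f = P ->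
  forall a, P * a = a -> a * P = a -> D a = D (e * a * e) + D (f * a * f).
Proof.
move=> Dl e f ee ff ef fe efP a Pa aP.
rewrite -{1}aP -{1}Pa -efP !(mulrDl, mulrDr) !raddfD /=.
rewrite (D_corner_offdiag Dl ee ff ef fe efP (m := e * a * f)); last 2 first.
- by rewrite !mulrA ee.
- by rewrite -!mulrA ff.
have feP : f + e = P by rewrite addrC.
rewrite (D_corner_offdiag Dl ff ee fe ef feP (m := f * a * e)); last 2 first.
- by rewrite !mulrA ff.
- by rewrite -!mulrA ee.
by rewrite addr0 add0r.
Qed.
End JordanAtIdempotent.

(** * Real parts of scalars and archimedean bounds *)

Section Scalars.
Variables (R : realType) (k : scalar_kind).
Local Notation K := (scalars R k).

Lemma ltr_sofR (r s : R) : (sofR k r < sofR k s) = (r < s).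
Proof.
rewrite !lt_neqAle ler_sofR; congr (~~ _ && _).
by apply/eqP/eqP => [/(congr1 (@sRe R k))|->//]; rewrite !sofRK.
Qed.

Lemma div_exp2n_lt (C eps : K) : 0 <= C -> 0 < eps ->
  exists n, forall m, (n <= m)%N -> C / 2 ^+ m < eps.
Proof.
move=> C0 eps0; have eps_ge0 := ltW eps0.
have CE := sReK C0; have epsE := sReK eps_ge0.
have e0 : 0 < sRe eps by rewrite -(ltr_sofR) rmorph0 epsE.
exists (Num.bound (sRe C / sRe eps)) => m nm.
rewrite -CE -epsE -[2](rmorph_nat (sofR k)) -rmorphXn -fmorphV -rmorphM.
rewrite ltr_sofR.
rewrite ltr_pdivrMr ?exprn_gt0// mulrC -ltr_pdivrMr//.
have c0 : 0 <= sRe C / sRe eps 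
  by apply: divr_ge0; rewrite ?(ltW e0)// -(ler_sofR k) rmorph0 CE.
apply: (lt_trans (archi_boundP c0)); rewrite -natrX ltr_nat.
by apply: (leq_ltn_trans nm); exact: ltn_expl.
Qed.
End Scalars.

(** * Elementary rules in the nest algebra *)

Section NestAlgebraTheory.
Variables (R : realType) (k : scalar_kind) (V : normedModType (scalars R k)).
Variable NN : nest V.
Implicit Types S T : nest_alg NN.

Lemma nest_algP S T : (forall x, S x = T x) -> S = T.
Proof. by move=> ST; apply/val_inj/bopP. Qed.

Lemma nest_algBE S T x : (S - T) x = S x - T x. Proof. by []. Qed.
Lemma nest_algME S T x : (S * T) x = S (T x). Proof. by []. Qed.
Lemma nest_alg1E x : (1 : nest_alg NN) x = x. Proof. by []. Qed.
Lemma nest_algZE a S x : (a *: S) x = a *: S x. Proof. by []. Qed.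

Lemma nest_alg_linear T a x y : T (a *: x + y) = a *: T x + T y.
Proof. exact: linearP. Qed.

Lemma nest_algZ T a x : T (a *: x) = a *: T x. Proof. exact: linearZ. Qed.

Lemma nest_algB T x y : T (x - y) = T x - T y. Proof. exact: linearB. Qed.

Lemma nest_alg_scalerAl a S T : a *: (S * T) = (a *: S) * T.
Proof. exact: nest_algP. Qed.

Lemma nest_alg_scalerAr a S T : a *: (S * T) = S * (a *: T).
Proof.
by apply: nest_algP => x; rewrite nest_algZE !nest_algME nest_algZE linearZ.
Qed.

Lemma nest_alg_torsion_free n T : T *+ n.+1 = 0 -> T = 0.
Proof.
by move/eqP; rewrite -scaler_nat scaler_eq0 pnatr_eq0 => /eqP.
Qed.

Lemma nest_alg_mem T N x : NN N -> N x -> N (T x).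
Proof. by move: (nest_op_mem T) => /nest_preservingP; exact. Qed.

Lemma normr_nest_alg T x : `|T x| <= `|T| * `|x|.
Proof. exact: ler_opnorm. Qed.

Lemma normr_nest_algX T n x : `|T| <= 2^-1 -> `|(T ^+ n) x| <= `|x| / 2 ^+ n.
Proof.
move=> T2; elim: n => [|n IH]; first by rewrite !expr0 divr1.
rewrite exprS nest_algME (le_trans (normr_nest_alg _ _))//.
by rewrite exprS invfM mulrCA ler_pM.
Qed.
End NestAlgebraTheory.

(** * Inversion of [1 - T] by the Neumann series *)

Section Neumann.
Variables (R : realType) (k : scalar_kind)
  (V : completeNormedModType (scalars R k)).
Local Notation K := (scalars R k).
Variable NN : nest V.
Variable T : nest_alg NN.
Hypothesis T2 : `|T| <= 2^-1.

Let S n := \sum_(i < n) T ^+ i.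

Let subTS n : (1 - T) * S n = 1 - T ^+ n.
Proof. by rewrite -[1 - T]opprB mulNr -subrX1 opprB. Qed.

Let normr_subT x : `|x| <= 2 * `|(1 - T) x|.
Proof.
have : `|x| <= `|(1 - T) x| + 2^-1 * `|x|.
  rewrite -{1}[x](subrK (T x)) (le_trans (ler_normD _ _))// lerD2l.
  by rewrite (le_trans (normr_nest_alg _ _))// ler_wpM2r.
rewrite -lerBlDr -{1}[`|x|]mul1r -mulrBl {1}[1](splitr 1) div1r addrK => h.
by rewrite -ler_pdivrMl.
Qed.

(** [1 - T] sends the left-hand vector to a difference of two powers of [T] at [x], whence a factor
    2; the other factor 2 comes from [normr_subT]. *)
Let normr_sub_S x n m : (n <= m)%N -> `|S n x - S m x| <= 4 * `|x| / 2 ^+ n.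
Proof.
move=> nm; rewrite (le_trans (normr_subT _))// nest_algB -!nest_algME !subTS.
rewrite !nest_algBE !nest_alg1E opprB addrC addrA subrK.
rewrite (natrM _ 2 2) -!mulrA ler_wpM2l// (le_trans (ler_normB _ _))//.
rewrite mulr_natl mulr2n lerD ?normr_nest_algX//.
rewrite (le_trans (normr_nest_algX _ _ T2))// ler_wpM2l//.
rewrite lef_pV2 ?posrE ?exprn_gt0//.
by rewrite ler_weXn2l// ler1n.
Qed.

(** The series is summed vector by vector in [V]; as members of the nest are closed, the limit stays
    in every member containing [x]. *)
Let neumann_solution x :
  exists p, (1 - T) p = x /\ forall N, NN N -> N x -> N p.
Proof.
pose F : set_system V := (fun n => S n x) @ \oo.
have FF : ProperFilter F by exact: fmap_proper_filter.
have Fc : cauchy F.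
  apply: cauchy_exP => eps eps0.
  have [n hn] := div_exp2n_lt (mulr_ge0 (ler0n _ 4) (normr_ge0 x)) eps0.
  exists (S n x); exists n => // m /= nm.
  rewrite -ball_normE /ball_ /= (le_lt_trans (normr_sub_S _ nm))//.
  exact: hn.
have Fp := @cauchy_cvg _ F FF Fc; set p := lim F in Fp.
exists p; split=> [|N NNN Nx].
  apply/eqP; rewrite -subr_eq0 -normr_le0; apply/ler_addgt0Pr => eps eps0.
  rewrite add0r.
  (* Three errors: [p - S m x], its image under [T], and the remainder [T ^+ m] at [x]. *)
  have eps30 : 0 < eps / 3 by rewrite divr_gt0.
  have [n hn] := div_exp2n_lt (normr_ge0 x) eps30.
  have [n' _ hn'] : F (ball p (eps / 3)) by apply: Fp; apply: nbhsx_ballx.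
  pose m := maxn n n'.
  have := hn' m; rewrite /= leq_maxr -ball_normE /ball_ /= => /(_ isT) pm.
  have -> : (1 - T) p - x = (1 - T) (p - S m x) - (T ^+ m) x.
    rewrite nest_algB -nest_algME subTS (nest_algBE 1 (T ^+ m)).
    by rewrite opprB [RHS]addrAC [RHS]addrA subrK.
  have Tx : `|(T ^+ m) x| <= eps / 3.
    rewrite (le_trans (normr_nest_algX _ _ T2))// ltW// hn//.
    exact: leq_maxl.
  have Tp : `|T (p - S m x)| <= eps / 3.
    rewrite (le_trans (normr_nest_alg _ _))// -[leRHS]mul1r ler_pM ?(ltW pm)//.
    by rewrite (le_trans T2)// invf_le1// ler1n.
  rewrite (le_trans (ler_normB _ _))//.
  have -> : eps = eps / 3 + eps / 3 + eps / 3.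
    by rewrite -[LHS](@divfK _ 3) ?pnatr_eq0// mulr_natr !mulrSr mulr0n add0r.
  rewrite lerD// nest_algBE nest_alg1E (le_trans (ler_normB _ _))// lerD//.
  exact: ltW.
apply: (@closed_cvg _ _ \oo _ (fun n => S n x) N (nest_closed NNN) _ p Fp).
by apply: nearW => n; exact: nest_alg_mem.
Qed.

(** The lower bound [normr_subT] makes [1 - T] injective, so the pointwise solutions form a linear
    map, bounded by 2. *)
Lemma nest_alg_neumann : exists W, (1 - T) * W = 1 /\ W * (1 - T) = 1.
Proof.
have [W hW] := choice neumann_solution.
have subT_inj x y : (1 - T) x = (1 - T) y -> x = y.
  move=> xy; apply/eqP; rewrite -subr_eq0 -normr_le0.
  by rewrite (le_trans (normr_subT _))// nest_algB xy subrr normr0 mulr0.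
have Wb : W \in @bounded_linear R k V.
  apply/bounded_linearP; split=> [a x y|].
    by apply: subT_inj; rewrite nest_alg_linear !(hW _).1.
  by exists 2 => x; have := normr_subT (W x); rewrite (hW x).1.
have WN : BOp Wb \in nest_preserving NN.
  by apply/nest_preservingP => N x NNN Nx; exact: (hW x).2.
exists (NestAlg WN); split; apply: nest_algP => x; first exact: (hW x).1.
by apply: subT_inj; exact: (hW _).1.
Qed.
End Neumann.

(** * Invertible elements of a corner *)

Section CornerUnits.
Variables (R : realType) (k : scalar_kind)
  (V : completeNormedModType (scalars R k)).
Variable NN : nest V.
Implicit Types y f b : nest_alg NN.

(** As [f] commutes with [1 - c *: y], compressing the Neumann inverse [W] to [f * W * f] inverts
    [f - c *: y] in the corner. *)
Lemma corner_neumann f y : f * f = f -> f * y = y -> y * f = y ->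
  exists2 c : scalars R k, c != 0 & exists2 z, f * z = z /\ z * f = z &
    z * (f - c *: y) = f /\ (f - c *: y) * z = f.
Proof.
move=> ff fy yf; have y1 : 0 < 2 * (`|y| + 1).
  by rewrite mulr_gt0// ltr_wpDl.
(* The norm of [c *: y] is at most 1/2; adding 1 to that of [y] covers [y = 0]. *)
set c := (2 * (`|y| + 1))^-1; exists c; first by rewrite invr_eq0 gt_eqF.
have cy2 : `|c *: y| <= 2^-1.
  rewrite normrZ ger0_norm ?invr_ge0 ?(ltW y1)// ler_pdivrMl//.
  by rewrite mulrAC mulfV ?pnatr_eq0// mul1r lerDl.
have [W [sW Ws]] := nest_alg_neumann cy2.
have fs : f - c *: y = f * (1 - c *: y).
  by rewrite mulrBr mulr1 -nest_alg_scalerAr fy.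
have sf : f - c *: y = (1 - c *: y) * f.
  by rewrite mulrBl mul1r -nest_alg_scalerAl yf.
exists (f * W * f); first by rewrite !mulrA ff -!mulrA ff.
have fsf : f * (f - c *: y) = f - c *: y by rewrite fs mulrA ff.
have sff : (f - c *: y) * f = f - c *: y by rewrite sf -mulrA ff.
split; first by rewrite -mulrA fsf sf -mulrA [W * _]mulrA Ws mul1r ff.
by rewrite !mulrA sff fs -[f * _ * W]mulrA sW mulr1 ff.
Qed.

(** [c *: y] is the difference of the units [f] and [f - c *: y], so linearity passes from units to
    the whole corner. *)
Lemma corner_units_span (D : {linear nest_alg NN -> nest_alg NN})
    (A f : nest_alg NN) :
  f * f = f ->
  (forall b b', f * b = b -> b * f = b -> f * b' = b' -> b' * f = b' ->
     b * b' = f -> b' * b = f -> A * D b' = 0) ->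
  forall y, f * y = y -> y * f = y -> A * D y = 0.
Proof.
move=> ff AD0 y fy yf.
have [c c0 [z [fz zf] [zs sz]]] := corner_neumann ff fy yf.
have ADs : A * D (f - c *: y) = 0.
  apply: (AD0 z) => //; first by rewrite mulrBr ff -nest_alg_scalerAr fy.
  by rewrite mulrBl ff -nest_alg_scalerAl yf.
move/eqP: ADs; rewrite linearB linearZ /= mulrBr (AD0 f f)// sub0r oppr_eq0.
by rewrite -nest_alg_scalerAr scaler_eq0 (negPf c0) => /eqP.
Qed.

End CornerUnits.

(** * Rank-one operators and projections in the nest algebra *)

Section RankOne.
Variables (R : realType) (k : scalar_kind) (H : hilbertType R k).
Local Notation K := (scalars R k).
Variable NN : nest H.
Implicit Types (x u z : H) (M : set H).

Lemma inner_sym x z : inner x z = sconj R k (inner z x).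
Proof. by rewrite hermC /= expr0 mul1r. Qed.

Lemma inner_eq0_sym x z : inner x z = 0 -> inner z x = 0.
Proof. by move=> xz0; rewrite inner_sym xz0 rmorph0. Qed.

Lemma cauchy_schwarz x z : `|inner x z| <= `|x| * `|z|.
Proof.
have [->|z0] := eqVneq z 0; first by rewrite linear0r !normr0 mulr0.
have zz : sconj R k (inner z z) = inner z z by rewrite -inner_sym.
rewrite -(ler_pXn2r (n := 2)) ?nnegrE ?mulr_ge0// exprMn -subr_ge0.
have zz0 : 0 < `|z| ^+ 2 by rewrite exprn_gt0// normr_gt0.
rewrite -(pmulr_rge0 _ zz0) mulrBr mulrCA -!innerE -mul_sconj -inner_sym.
have := exprn_ge0 2 (normr_ge0 (inner z z *: x - inner x z *: z)).
rewrite -innerE linearBl linearBr /= !linearZl_LR !linearZr_LR /= linearBr.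
rewrite !linearZr_LR /= zz -inner_sym; congr (_ <= _).
by move: (inner z z) (inner x z) (inner z x) (inner x x) => a b c d; ring.
Qed.

Lemma nest_rank_one u z :
  (forall M, NN M -> M u \/ forall x, M x -> inner x z = 0) ->
  exists T : nest_alg NN, forall x, T x = inner x z *: u.
Proof.
move=> hM; pose t x := inner x z *: u.
have tb : t \in @bounded_linear R k H.
  apply/bounded_linearP; split=> [a x y|].
    by rewrite /t linearDl linearZl_LR /= scalerDl scalerA.
  exists (`|z| * `|u|) => x; rewrite normrZ mulrAC [`|z| * _]mulrC.
  by rewrite ler_wpM2r// cauchy_schwarz.
have tN : BOp tb \in nest_preserving NN.
  apply/nest_preservingP => M x NNM Mx; rewrite /= /t.
  have [M0 Ml] := nest_lin_subspace NNM.
  case: (hM _ NNM) => [Mu|->//]; last by rewrite scale0r.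
  by rewrite -[_ *: u]addr0; exact: Ml.
by exists (NestAlg tN).
Qed.

Section NestProjection.
Variables (N : set H) (NNN : NN N).
Let P := nest_proj NNN.

Lemma nest_proj_mem x : N (P x).
Proof.
by have [] := orth_projP (nest_lin_subspace NNN) (nest_closed NNN) x.
Qed.

Lemma nest_proj_orth x y : N y -> inner (x - P x) y = 0.
Proof.
have [_] := orth_projP (nest_lin_subspace NNN) (nest_closed NNN) x; exact.
Qed.

Lemma nest_proj_id x : N x -> P x = x.
Proof.
move=> Nx.
apply: (orth_proj_unique (nest_lin_subspace NNN) (nest_closed NNN)) => // y _.
by rewrite subrr linear0l.
Qed.

Lemma nest_proj_idem : P * P = P.
Proof. by apply: nest_algP => x; exact/nest_proj_id/nest_proj_mem. Qed.

Lemma nest_proj_invariant (T : nest_alg NN) : P * T * P = T * P.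
Proof.
apply: nest_algP => x; rewrite -mulrA nest_algME nest_proj_id//.
by rewrite nest_algME; apply: nest_alg_mem => //; exact: nest_proj_mem.
Qed.

Lemma nest_proj_eq0_orth x y : P x = 0 -> N y -> inner x y = 0.
Proof. by move=> Px Ny; have := nest_proj_orth x Ny; rewrite Px subr0. Qed.

(** If [z = t x], then [z] is orthogonal to [N]. For nonzero [u] in [N] the map sending [y] to
    [inner y z *: u] is in the algebra, each member of the nest containing [N] or being orthogonal
    to [z]; its product with [F] serves as [m]. The idempotent [F] is later [1 - P] or a difference
    of two nest projections. *)
Lemma nest_proj_faithful F t : N <> [set 0] -> F * F = F -> F * t = t ->
  P * t = 0 -> (forall m, P * m = m -> m * F = m -> m * t = 0) -> t = 0.
Proof.
move=> N0 FF Ft Pt mt0.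
have [u [Nu u0]] : exists u, N u /\ u != 0.
  apply: contrapT => /forallNP h; apply: N0; apply/seteqP; split=> [y Ny|_ ->].
    by have := h y; apply: contra_notP => /eqP y0; split.
  exact: (nest_lin_subspace NNN).1.
apply: nest_algP => x; set z := t x.
have Pz : P z = 0 by rewrite -[LHS]/((P * t) x) Pt.
have [|r hr] := @nest_rank_one u z.
  move=> M NNM; have [NM|MN] := (nestP NN).2 _ _ NNN NNM.
    by left; apply: NM.
  right=> y My; apply: inner_eq0_sym; apply: nest_proj_eq0_orth Pz _.
  exact: MN.
have := mt0 (r * F) _ _; rewrite -mulrA FF mulrA => /(_ _ erefl).
have -> : P * r = r.
  apply: nest_algP => y; apply: nest_proj_id; rewrite hr.
  rewrite -[_ *: u]addr0; apply: (nest_lin_subspace NNN).2 => //.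
  exact: (nest_lin_subspace NNN).1.
rewrite -mulrA Ft => /(_ erefl) rt.
have : (r * t) x = 0 by rewrite rt.
rewrite nest_algME hr => /eqP; rewrite scaler_eq0 (negPf u0) orbF innerE.
by rewrite sqrf_eq0 normr_eq0 => /eqP.
Qed.

End NestProjection.

Lemma nest_proj_sub M N (NNM : NN M) (NNN : NN N) : M `<=` N ->
  nest_proj NNN * nest_proj NNM = nest_proj NNM /\
  nest_proj NNM * nest_proj NNN = nest_proj NNM.
Proof.
move=> MN; split; apply: nest_algP => x.
  by rewrite nest_algME nest_proj_id//; apply: MN; exact: nest_proj_mem.
apply: (orth_proj_unique (nest_lin_subspace NNM) (nest_closed NNM)).
  exact: nest_proj_mem.
move=> y My.
rewrite -[X in inner X _](subrKA x) -opprB linearDl linearNl /=.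
by rewrite !nest_proj_orth ?oppr0 ?addr0//; exact: MN.
Qed.

End RankOne.

(** * Vanishing on the corner of [P] *)

Section ZeroOnCorner.
Variables (R : realType) (k : scalar_kind) (H : hilbertType R k).
Variables (NN : nest H) (N : set H) (NNN : NN N).
Let P := nest_proj NNN.
Variable D : {linear nest_alg NN -> nest_alg NN}.
Hypothesis DP : D P = 0.
Hypothesis jordanD :
  forall (n : nat) A B, A * B + B * A = P *+ n.+1 -> A * D B + B * D A = 0.

Let PP : P * P = P := nest_proj_idem NNN.
Let torsion := @nest_alg_torsion_free R k H NN.

Lemma D_corner_left a : P * a = a -> a * P = a -> D a = P * D a.
Proof.
move=> Pa aP; apply/eqP.
rewrite -subr_eq0 -[X in X - _]mul1r -mulrBl; apply/eqP.
apply: (corner_units_span (f := P)) => // b b' Pb bP Pb' b'P bb' b'b.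
by rewrite mulrBl mul1r -(D_corner_unit _ _ Pb bP Pb' b'P) ?subrr.
Qed.

Let unitD := corner_unit_D torsion DP jordanD D_corner_left.
Let offdiagD := offdiag_corner_unit_D torsion DP jordanD D_corner_left.
Let diagonalD := D_diagonal torsion DP jordanD D_corner_left.

Lemma D_corner_nest a x M : P * a = a -> a * P = a -> NN M -> M <> [set 0] ->
  M (D a x).
Proof.
move=> Pa aP NNM M0; have [NM|MN] := (nestP NN).2 _ _ NNN NNM.
  by apply: NM; rewrite D_corner_left//; exact: nest_proj_mem.
pose E := nest_proj NNM; pose F := P - E.
have [PE EP] := nest_proj_sub NNM NNN MN.
have EE : E * E = E := nest_proj_idem NNM.
have EF : E * F = 0 by rewrite mulrBr EP EE subrr.
have FE : F * E = 0 by rewrite mulrBl PE EE subrr.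
have FF : F * F = F by rewrite mulrBr FE subr0 mulrBl PP EP.
have EFP : E + F = P by rewrite addrC subrK.
have FEP : F + E = P by rewrite subrK.
have PF : P * F = F by rewrite mulrBr PP PE.
(* For a unit [b'], [D b'] is killed by [E] and by all of [E Alg F], hence is zero by
   faithfulness. *)
have DFaF : D (F * a * F) = 0.
  rewrite -[LHS]mul1r; apply: (corner_units_span FF).
  - move=> b b' Fb bF Fb' b'F bb' b'b; rewrite mul1r.
    have EDb' : E * D b' = 0.
      exact: (unitD EE FF EF FE EFP Fb bF).
    have b'P : b' * P = b'.
      by rewrite -EFP mulrDr b'F -b'F -mulrA FE mulr0 add0r.
    apply: (nest_proj_faithful M0 FF _ EDb').
      rewrite mulrBl EDb' subr0 -D_corner_left//.
      by rewrite -Fb' mulrA PF.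
    move=> m Em mF.
    exact: (offdiagD EE FF EF FE EFP Fb bF).
  - by rewrite !mulrA FF.
  - by rewrite -!mulrA FF.
have FDEaE : F * D (E * a * E) = 0.
  apply: (corner_units_span EE).
  - move=> b b' Eb bE Eb' b'E bb' b'b.
    exact: (unitD FF EE FE EF FEP Eb bE).
  - by rewrite !mulrA EE.
  - by rewrite -!mulrA EE.
have Da : D a = D (E * a * E) + D (F * a * F).
  exact: (diagonalD EE FF EF FE EFP).
have -> : D a = E * D a.
  rewrite {1}D_corner_left// -{1}EFP mulrDl.
  by rewrite [in F * _]Da DFaF addr0 FDEaE addr0.
exact: nest_proj_mem.
Qed.

Lemma D_corner a : P * a = a -> a * P = a -> D a = 0.
Proof.
move=> Pa aP; apply: nest_algP => x; set v := D a x.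
have vM M : NN M -> M <> [set 0] -> M v by exact: D_corner_nest.
apply/eqP; apply: contraT => v0; have vv0 : inner v v != 0.
  by rewrite innerE sqrf_eq0 normr_eq0.
(* The factor [(inner v v)^-1] makes the operator fix [v], so it projects onto the line of [v]. *)
have [|e eE] := @nest_rank_one _ _ _ NN ((inner v v)^-1 *: v) v.
  move=> M NNM; have [->|M0] := pselect (M = [set 0]).
    by right=> y ->; rewrite linear0l.
  left; rewrite -[_ *: v]addr0; apply: (nest_lin_subspace NNM).2.
    exact: vM.
  exact: (nest_lin_subspace NNM).1.
have ev : e v = v by rewrite eE scalerA mulfV// scale1r.
have Pv : P v = v by rewrite /v -nest_algME -D_corner_left.
have N0 : N v by rewrite -Pv; exact: nest_proj_mem.
have ewZ w : e w = (inner w v / inner v v) *: v by rewrite eE scalerA.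
have ee : e * e = e.
  by apply: nest_algP => w; rewrite nest_algME [e w]ewZ nest_algZ ev.
have Pe : P * e = e.
  by apply: nest_algP => w; rewrite nest_algME [e w]ewZ nest_algZ Pv.
have eP : e * P = e.
  apply: nest_algP => w; rewrite nest_algME !ewZ; congr (_ / _ *: _).
  apply/esym/eqP; rewrite -subr_eq0 -linearBl /=; apply/eqP.
  exact: (nest_proj_orth NNN w N0).
pose f := P - e.
have ef : e * f = 0 by rewrite mulrBr eP ee subrr.
have fe : f * e = 0 by rewrite mulrBl Pe ee subrr.
have ff : f * f = f by rewrite mulrBr fe subr0 mulrBl PP eP.
have efP : e + f = P by rewrite addrC subrK.
have De : D e = 0.
  exact: (D_idempotent_l torsion DP jordanD D_corner_left ee ff ef fe efP).
have eae : e * a * e = (inner (a v) v / inner v v) *: e.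
  apply: nest_algP => w; rewrite !nest_algME nest_algZE [e w]ewZ !nest_algZ.
  by rewrite [e (a v)]ewZ !scalerA mulrC.
have Da : D a = D (e * a * e) + D (f * a * f).
  exact: (diagonalD ee ff ef fe efP).
have eD : e * D a = 0.
  rewrite Da.
  rewrite eae linearZ /= De scaler0 add0r.
  apply: (corner_units_span ff).
  - move=> b b' fb bf fb' b'f bb' b'b.
    exact: (unitD ee ff ef fe efP fb bf).
  - by rewrite !mulrA ff.
  - by rewrite -!mulrA ff.
by case/eqP: v0; rewrite -ev /v -nest_algME eD.
Qed.

End ZeroOnCorner.

Theorem corollary2p9 (R : realType) (k : scalar_kind) (H : hilbertType R k)
    (NN : nest H) (N : set H) (NNN : NN N) (N_neq0 : N <> [set 0])
    (N_neqT : N <> setT)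
    (delta : {linear nest_alg NN -> nest_alg NN})
    (delta_continuous : continuous delta) :
  (forall A B : nest_alg NN, A * B + B * A = nest_proj NNN ->
     2 * A * delta B + 2 * B * delta A = delta (nest_proj NNN)) <->
  (forall A : nest_alg NN, delta A = A * delta 1) /\
  nest_proj NNN * delta 1 = 0.
Proof.
set P := nest_proj NNN; have PP : P * P = P := nest_proj_idem NNN.
split=> [h|[deltaE Pd1] A B AB]; last first.
  (* The left side becomes [2 P delta(1)] and the right side [P delta(1)]; both are zero. *)
  rewrite (deltaE A) (deltaE B) (deltaE P) !mulrA -mulrDl.
  rewrite -[2 * A * B]mulrA -[2 * B * A]mulrA.
  by rewrite -mulrDr AB -mulrA Pd1 mulr0.
have key n A B : A * B + B * A = P *+ n.+1 ->
    (A * delta B + B * delta A) *+ 2 = delta P *+ n.+1.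
  (* Dividing [B] by [n.+1] brings the anticommutator back to [P] itself. *)
  move=> AB; pose c : scalars R k := n.+1%:R.
  have c0 : c != 0 by rewrite pnatr_eq0.
  have := h A (c^-1 *: B).
  rewrite -nest_alg_scalerAr -nest_alg_scalerAl -scalerDr AB -scaler_nat.
  rewrite scalerA mulVf// scale1r => /(_ erefl) <-.
  rewrite linearZ /= -!nest_alg_scalerAr -nest_alg_scalerAl -scalerDr.
  by rewrite -[RHS]scaler_nat scalerA mulfV// scale1r -!mulrA -mulrDr mulr_natl.
have DP : delta P = 0.
  (* The pair [P], [P] gives [2 P delta(P) = delta(P)]; a further factor [P] forces
     [P delta(P) = 0]. *)
  have : P * delta P *+ 2 = delta P.
    apply/eqP; rewrite -subr_eq0; apply/eqP/(@nest_alg_torsion_free _ _ _ _ 1).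
    by rewrite mulrnBl -(key 1%N P P) ?PP// -mulr2n subrr.
  move=> dP; rewrite -dP; apply/eqP; have /eqP := congr1 ( *%R P) dP.
  by rewrite mulrnAr mulrA PP mulr2n -subr_eq0 addrK => /eqP ->; rewrite addr0.
have jordanD n A B : A * B + B * A = P *+ n.+1 -> A * delta B + B * delta A = 0.
  by move/key; rewrite DP mul0rn => /nest_alg_torsion_free.
have PQ : P * (1 - P) = 0 by exact: PQ0.
have QP : (1 - P) * P = 0 by exact: QP0.
split=> [A|].
  apply: (D_from_corners PP DP jordanD) => [b|a|].
  - apply: (D_compl_cornerE PP DP jordanD) => t Pt mt.
    apply: (nest_proj_faithful (NNN := NNN) N_neq0 (F := 1 - P)) => //.
    + by rewrite mulrBl mul1r PQ subr0.
    + by rewrite mulrBl mul1r Pt subr0.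
    + by move=> m Pm mQ; apply: mt => //; rewrite -mQ -mulrA QP mulr0.
  - exact: (@D_corner _ _ _ _ _ NNN).
  - exact: nest_proj_invariant.
rewrite -[1](subrK P) linearD DP addr0.
exact: (D_compl_corner PP DP jordanD).
Qed.
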